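(* (i) Let $L$ be an upper semimodular lattice of finite length. If $\operatorname{br}(L)\le 2$, then $L$ satisfies the $c_1$-median property. (ii) For each integer $k\ge 3$ there exists a finite upper semimodular lattice of breadth $k$ that fails to satisfy the $c_1$-median property. (iii) Let $t$ be a positive integer and, for $i=1,\dots,t$, let $L_i$ be a lattice of finite length satisfying the $c_1$-median property. Then the direct product $L:=L_1\times\dots\times L_t$ is a lattice of finite length, and it satisfies the $c_1$-median property. If all the $L_i$ are of finite breadth, then $\operatorname{br}(L)=\operatorname{br}(L_1)+\dots+\operatorname{br}(L_t)$. Furthermore, if all the $L_i$ are upper semimodular, then so is $L$.
   Context: A lattice is upper semimodular (semimodular) if for all $x,y$, $x\wedge y\prec x$ implies $y\prec x\vee y$, where $\prec$ is the covering relation. For a lattice $L$ of finite length, $d(x,y)$ denotes the length of a shortest path between $x$ and $y$ in the covering graph of $L$, i.e. the undirected graph on $L$ whose edges are the pairs $\{a,b\}$ with $a\prec b$. For a profile $\xi=(x_1,\dots,x_k)\in L^k$, an element $y\in L$ is a median of $\xi$ if $r(y,\xi):=\sum_{i=1}^k d(y,x_i)$ is minimum over $L$. $M(\xi)$ is the set of medians of $\xi$, and $c_1(\xi):=x_1\vee\dots\vee x_k$. The lattice $L$ satisfies the $c_1$-median property if, for every $k\ge 1$, every $\xi\in L^k$ and every $y\in M(\xi)$, we have $y\le c_1(\xi)$. The breadth $\operatorname{br}(L)$ of a lattice $L$ is the least positive integer $n$ such that every join $\bigvee_{i=1}^m x_i$ with $x_i\in L$ and $m\ge n$ equals the join of some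 $n$ of the joinands $x_i$. By convention, the singleton lattice has breadth $0$. *)

(* Defs.v *)
From HB Require Import structures.
From mathcomp Require Import all_boot all_order.
From Stdlib Require Import ClassicalEpsilon.
Set Implicit Arguments. Unset Strict Implicit. Unset Printing Implicit Defensive.
Import Order.TTheory.
Local Open Scope order_scope.

Section DProd.
Variables (I : finType) (dL : I -> Order.disp_t) (L : forall i, tbLatticeType (dL i)).

Definition dprodL : Type := {dffun forall i : I, L i}.
HB.instance Definition _ := Choice.on dprodL.

Definition dprod_le (f g : dprodL) : bool := [forall i, f i <= g i].
Definition dprod_lt (f g : dprodL) : bool := (g != f) && dprod_le f g.

Lemma dprod_le_refl : reflexive dprod_le.
Proof. by move=> f; apply/forallP=> i. Qed.
Lemma dprod_le_anti : antisymmetric dprod_le.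
Proof.
move=> f g /andP[/forallP fg /forallP gf]; apply/ffunP=> i.
by apply/le_anti; rewrite fg gf.
Qed.
Lemma dprod_le_trans : transitive dprod_le.
Proof.
move=> g f h /forallP fg /forallP gh; apply/forallP=> i.
exact: le_trans (fg i) (gh i).
Qed.

HB.instance Definition _ := Order.isPOrder.Build (Order.Disp tt tt) dprodL
  (fun _ _ => erefl) dprod_le_refl dprod_le_anti dprod_le_trans.

Definition dprod_meet (f g : dprodL) : dprodL := [ffun i => f i `&` g i].
Definition dprod_join (f g : dprodL) : dprodL := [ffun i => f i `|` g i].

Lemma dprod_meetP (f g h : dprodL) :
  (f <= dprod_meet g h) = (f <= g) && (f <= h).
Proof.
apply/forallP/andP => [H|[/forallP H1 /forallP H2]].
  by split; apply/forallP=> i; have := H i; rewrite ffunE lexI => /andP[].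
by move=> i; rewrite ffunE lexI H1 H2.
Qed.
Lemma dprod_joinP (f g h : dprodL) :
  (dprod_join f g <= h) = (f <= h) && (g <= h).
Proof.
apply/forallP/andP => [H|[/forallP H1 /forallP H2]].
  by split; apply/forallP=> i; have := H i; rewrite ffunE leUx => /andP[].
by move=> i; rewrite ffunE leUx H1 H2.
Qed.

HB.instance Definition _ := Order.POrder_MeetJoin_isLattice.Build (Order.Disp tt tt)
  dprodL dprod_meetP dprod_joinP.

Lemma dprod_le0x (f : dprodL) : ([ffun i => \bot] : dprodL) <= f.
Proof. by apply/forallP=> i; rewrite ffunE le0x. Qed.
Lemma dprod_lex1 (f : dprodL) : f <= ([ffun i => \top] : dprodL).
Proof. by apply/forallP=> i; rewrite ffunE lex1. Qed.

HB.instance Definition _ := Order.hasBottom.Build (Order.Disp tt tt) dprodL dprod_le0x.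
HB.instance Definition _ := Order.hasTop.Build (Order.Disp tt tt) dprodL dprod_lex1.

End DProd.


Section LatticeNotions.
Context {d : Order.disp_t} (T : tbLatticeType d).

Definition covers (x y : T) : Prop :=
  x < y /\ forall z : T, ~ (x < z /\ z < y).

(* finite length: the lengths (number of elements minus one) of all chains
   are bounded by some n *)
Definition finite_length : Prop :=
  exists n : nat, forall s : seq T, sorted <%O s -> (size s <= n.+1)%N.

Definition upper_semimodular : Prop :=
  forall x y : T, covers (x `&` y) x -> covers y (x `|` y).

Definition cg_adj (a b : T) : Prop := covers a b \/ covers b a.

Fixpoint walk (x : T) (s : seq T) (y : T) : Prop :=
  match s with
  | [::] => x = y
  | z :: s' => cg_adj x z /\ walk z s' y
  end.

(* d(x,y): length of a shortest walk from x to y in the covering graph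
   (chosen by Hilbert's epsilon; in a lattice of finite length such a shortest
   walk always exists) *)
Definition cdist (x y : T) : nat :=
  epsilon (inhabits 0%N) (fun n : nat =>
    (exists s, walk x s y /\ size s = n) /\
    forall s, walk x s y -> (n <= size s)%N).

Definition rdist (y : T) (xi : seq T) : nat := (\sum_(x <- xi) cdist y x)%N.

Definition is_median (xi : seq T) (y : T) : Prop :=
  forall z : T, (rdist y xi <= rdist z xi)%N.

Definition c1 (xi : seq T) : T := \join_(x <- xi) x.

Definition c1_median_property : Prop :=
  forall xi : seq T, (1 <= size xi)%N ->
  forall y : T, is_median xi y -> y <= c1 xi.

Definition breadth_prop (n : nat) : Prop :=
  forall (m : nat) (x : 'I_m -> T), (n <= m)%N ->
  exists S : {set 'I_m}, #|S| = n /\ \join_(i in S) x i = \join_(i < m) x i.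

Definition has_breadth (n : nat) : Prop :=
  ((forall x y : T, x = y) /\ n = 0%N) \/
  ((exists x y : T, x <> y) /\ (0 < n)%N /\ breadth_prop n /\
     forall n' : nat, (0 < n')%N -> breadth_prop n' -> (n <= n')%N).

Definition finite_breadth : Prop := exists n, has_breadth n.

End LatticeNotions.

(* Main.v *)
(** (i) In an upper semimodular lattice with rank h one has d(x,y) = 2h(x v y) - h(x) - h(y). If y
    is a median of (x_1,...,x_k) not below j = x_1 v ... v x_k, breadth at most two makes the
    elements y v x_i a chain. For a middle element w of this chain, moving from y up to w does not
    increase the total distance, and moving from w down to w /\ j decreases it, since more than
    half of the x_i lie below w.

    (ii) In breadth three, we take the flats of an explicit submodular function on a product of
    three chains. Multiplying by k - 3 two-element chains raises the breadth to k.

    (iii) Coverings in a product are coverings in a single coordinate, so distances, and hence the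
    median condition, split coordinatewise. The breadth is the largest size of an irredundant
    family of joinands, and in a product each member of such a family is irredundant already in
    some coordinate. *)

Require Import Defs.
From HB Require Import structures.
From mathcomp Require Import all_boot all_order.
From mathcomp Require Import zify.
From Stdlib Require Import Classical ClassicalEpsilon.
Set Implicit Arguments. Unset Strict Implicit. Unset Printing Implicit Defensive.
Import Order.TTheory.
Local Open Scope order_scope.

(** * Ranks and distances in lattices of finite length *)

Section Covering.
Context {d : Order.disp_t} {T : tbLatticeType d}.
Implicit Types (x y z : T) (s : seq T).

Lemma finite_length_of_rank (h : T -> nat) (n : nat) :
  (forall x y, x < y -> (h x < h y)%N) -> (forall x, (h x <= n)%N) ->
  finite_length T.
Proof.
move=> hlt hn; exists n => s ss.
have us : uniq (map h s).
  apply: (sorted_uniq ltn_trans ltnn).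
  by rewrite sorted_map; apply: sub_sorted ss => x y /hlt.
rewrite -(size_map h) -(size_iota 0 n.+1); apply: uniq_leq_size => // _ /mapP[x _ ->].
by rewrite mem_iota /= add0n ltnS hn.
Qed.

Definition chain_above x (n : nat) : Prop :=
  exists s, path <%O x s /\ size s = n.

(** [D x] is the greatest length of a chain starting at [x]; finite length bounds these lengths. *)
Lemma finite_length_depth : finite_length T ->
  exists D : T -> nat,
    [/\ forall x, chain_above x (D x),
        forall x n, chain_above x n -> (n <= D x)%N,
        forall x y, x < y -> (D y < D x)%N
      & forall x, (D x <= D \bot)%N].
Proof.
move=> [b hb].
suff H x : exists m, chain_above x m /\ forall n, chain_above x n -> (n <= m)%N.
  pose D x := proj1_sig (constructive_indefinite_description _ (H x)).
  have DP x : chain_above x (D x) /\ forall n, chain_above x n -> (n <= D x)%N.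
    by rewrite /D; case: constructive_indefinite_description.
  have Dlt x y : x < y -> (D y < D x)%N.
    move=> xy; apply: (proj2 (DP x)); case: (proj1 (DP y)) => s [ps <-].
    by exists (y :: s); rewrite /= xy.
  exists D; split=> // [x|x n|x]; [by case: (DP x)|by case: (DP x) => _; apply|].
  have := le0x x; rewrite le_eqVlt => /orP[/eqP<-//|/Dlt]; exact: ltnW.
pose P n : bool := if excluded_middle_informative (chain_above x n) then true else false.
have PP n : reflect (chain_above x n) (P n).
  by rewrite /P; case: excluded_middle_informative => h; constructor.
have exP : exists n, P n by exists 0; apply/PP; exists [::].
have bP n : P n -> (n <= b)%N.
  by move=> /PP[s [ps <-]]; have := hb (x :: s) ps.
case: (ex_maxnP exP bP) => m /PP Pm mP; exists m; split=> // n /PP; exact: mP.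
Qed.

Lemma finite_length_rank : finite_length T ->
  exists (h : T -> nat) (n : nat),
    (forall x y, x < y -> (h x < h y)%N) /\ (forall x, (h x <= n)%N).
Proof.
move=> /finite_length_depth[D [_ _ Dlt D0]].
exists (fun x => D \bot - D x)%N, (D \bot); split=> [x y xy|x]; last lia.
by have := D0 x; have := Dlt _ _ xy; lia.
Qed.

(** Replacing [y] by an element strictly between lowers its rank, so the descent stops at a cover of
    [x]. *)
Lemma lt_covers x y : finite_length T -> x < y ->
  exists z, covers x z /\ z <= y.
Proof.
move=> /finite_length_rank[h [_ [hlt _]]].
have [n] := ubnP (h y); elim: n y => // n IH y hy xy.
have [c|nc] := classic (covers x y); first by exists y.
have [z /andP[xz zy]] : exists z, x < z < y.
  apply: NNPP => nz; apply: nc; split=> // z [xz zy].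
  by apply: nz; exists z; rewrite xz.
have [|w [xw wz]] := IH z _ xz; first by have := hlt _ _ zy; lia.
by exists w; split=> //; exact: le_trans wz (ltW zy).
Qed.

Lemma cg_adj_sym x y : cg_adj x y -> cg_adj y x.
Proof. by case; [right|left]. Qed.

Lemma walk_cat x y z s1 s2 : walk x s1 y -> walk y s2 z -> walk x (s1 ++ s2) z.
Proof. by elim: s1 x => /= [x ->//|a s IH x [xa w] w2]; split=> //; exact: IH. Qed.

Lemma walk_sym x y s : walk x s y -> exists s', walk y s' x /\ size s' = size s.
Proof.
elim: s x => /= [x ->|a s IH x [xa /IH[s' [w <-]]]]; first by exists [::].
exists (s' ++ [:: x]); split; last by rewrite size_cat addn1.
by apply: (walk_cat w); split=> //; exact: cg_adj_sym.
Qed.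

Definition graded (rho : T -> nat) : Prop :=
  forall x y, covers x y -> rho y = (rho x).+1.

Lemma le_walk x y : finite_length T -> x <= y ->
  exists s, walk x s y /\ forall rho, graded rho -> rho y = (rho x + size s)%N.
Proof.
move=> fl; have [h [b [hlt hb]]] := finite_length_rank fl.
have [n] := ubnP (b - h x)%N; elim: n x => // n IH x hx.
rewrite le_eqVlt => /orP[/eqP->|xy]; first by exists [::]; split=> // rho _; rewrite addn0.
have [z [xz zy]] := lt_covers fl xy.
have [|s [w sz]] := IH z _ zy.
  by have := hlt _ _ (proj1 xz); have := hb z; lia.
exists (z :: s); split; first by split=> //; left.
by move=> rho gr; rewrite (sz _ gr) (gr _ _ xz) /= addSnnS.
Qed.

Lemma graded_le rho x y : finite_length T -> graded rho -> x <= y ->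
  (rho x <= rho y)%N.
Proof. by move=> fl gr /(le_walk fl)[s [_ /(_ _ gr) ->]]; exact: leq_addr. Qed.

Lemma graded_lt rho x y : finite_length T -> graded rho -> x < y ->
  (rho x < rho y)%N.
Proof.
move=> fl gr /(lt_covers fl)[z [/gr xz /(graded_le fl gr)]].
by rewrite xz.
Qed.

Lemma finite_length_connected x y : finite_length T -> exists s, walk x s y.
Proof.
move=> fl; have [s1 [w1 _]] := le_walk fl (lex1 x).
have [s2 [/walk_sym[s3 [w3 _]] _]] := le_walk fl (lex1 y).
by exists (s1 ++ s3); exact: walk_cat w1 w3.
Qed.

(** The epsilon in [cdist] picks a genuine value: any two elements are linked through [\top], and a
    shortest walk is found by descent on the length. *)
Lemma cdistP x y : finite_length T ->
  (exists s, walk x s y /\ size s = cdist x y) /\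
  forall s, walk x s y -> (cdist x y <= size s)%N.
Proof.
move=> fl; rewrite /cdist; apply: (epsilon_spec _ (fun n : nat =>
  (exists s, walk x s y /\ size s = n) /\
  forall s, walk x s y -> (n <= size s)%N)).
have [s0 ws0] := finite_length_connected x y fl.
have [n] := ubnP (size s0); elim: n s0 ws0 => // n IH s ws sn.
have [H|H] := classic (forall t, walk x t y -> (size s <= size t)%N).
  by exists (size s); split=> //; exists s.
have [t /not_all_ex_not H1] := not_all_ex_not _ _ H.
have [wt lt] := H1; apply: (IH t wt); move: lt => /negP; lia.
Qed.

Lemma cdist_unique x y n : finite_length T ->
  (exists s, walk x s y /\ size s = n) ->
  (forall s, walk x s y -> (n <= size s)%N) -> cdist x y = n.
Proof.
move=> fl [s [ws <-]] H; have [[t [wt <-]] K] := cdistP x y fl.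
by have := H _ wt; have := K _ ws; case: (cdistP x y fl) => _ /(_ _ ws); lia.
Qed.

Lemma cdistxx x : finite_length T -> cdist x x = 0.
Proof. by move=> fl; apply: (cdist_unique fl) => //; exists [::]. Qed.

Lemma cdist_adj x y z : finite_length T -> cg_adj x z ->
  (cdist x y <= (cdist z y).+1)%N.
Proof.
move=> fl xz; have [[s [ws <-]] _] := cdistP z y fl.
by apply: (proj2 (cdistP x y fl) (z :: s)).
Qed.

(** * Upper semimodular lattices: gradedness and the distance formula *)

Section Semimodular.
Hypotheses (fl : finite_length T) (usm : upper_semimodular T).

(** The meet of [y] with x v z lies between [x] and [y], so it is one of them: [y] gives equal
    joins, [x] gives a covering by semimodularity. *)
Lemma covers_join x y z : covers x y -> x `|` z = y `|` z \/ covers (x `|` z) (y `|` z).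
Proof.
move=> [xy c]; have xy' := ltW xy.
have E : y `|` z = y `|` (x `|` z) by rewrite joinA (join_l xy').
have [yxz|yxz] := boolP (y <= x `|` z); [left|right].
  by rewrite E; apply/esym/join_r.
have yE : y `&` (x `|` z) = x.
  apply/eqP; rewrite eq_sym eq_le lexI xy' leUl /=; apply/negP => H.
  apply: (c (y `&` (x `|` z))).
  rewrite !lt_neqAle leIl lexI xy' leUl /= !andbT; split; apply/eqP.
    by move=> F; rewrite -F lexx in H.
  by move=> /meet_idPl F; rewrite F in yxz.
by rewrite E; apply: usm; rewrite yE.
Qed.

(* Upper semimodularity pushes a chain above [x] up to the cover [y] of [x], losing one step; hence
   the depth (greatest length of a chain above an element) drops by exactly one along coverings. *)
Lemma chain_above_covers n x y : covers x y -> chain_above x n.+1 -> chain_above y n.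
Proof.
elim: n x y => [|n IH] x y xy; first by exists [::].
move=> [s [ps sz]]; case: s ps sz => [|w [|v s]] //= /and3P[xw wv vs] [sz].
have [w' [xw' w'w]] := lt_covers fl xw.
have cw : chain_above w' n.+1.
  by exists (v :: s); rewrite /= (le_lt_trans w'w wv) vs /= sz.
have [<-//|neq] := eqVneq w' y.
have [|] := covers_join y xw'.
- rewrite (join_r (ltW (proj1 xy))) => E.
  have : w' <= y by rewrite E leUl.
  rewrite le_eqVlt (negbTE neq) /= => lt.
  by case: (proj2 xy w'); split=> //; case: xw'.
- rewrite (join_r (ltW (proj1 xy))) => cy.
  have [E|cw'] := covers_join w' xy.
    have : y <= w' by rewrite -[w'](join_r (ltW (proj1 xw'))) E leUl.
    rewrite le_eqVlt eq_sym (negbTE neq) /= => lt.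
    by case: (proj2 xw' y); split=> //; case: xy.
  rewrite (join_r (ltW (proj1 xw'))) joinC in cw'.
  have [t [pt st]] := IH _ _ cw' cw.
  by exists (w' `|` y :: t); rewrite /= (proj1 cy) pt st.
Qed.

Lemma semimodular_graded : exists rho : T -> nat, graded rho.
Proof.
have [D [Dc Dmax Dlt D0]] := finite_length_depth fl.
exists (fun x => D \bot - D x)%N => x y xy.
have := Dlt _ _ (proj1 xy); have := D0 x.
suff : (D x <= (D y).+1)%N by lia.
have := Dc x; case: (D x) => // n /(chain_above_covers xy); exact: Dmax.
Qed.

(* Along an edge of a walk, [2 rho (x v y) - rho x] changes by exactly one. *)
Lemma cdist_graded rho x y : graded rho ->
  (cdist x y + rho x + rho y = 2 * rho (x `|` y))%N.
Proof.
move=> gr.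
have lower s z : walk z s y -> (2 * rho (z `|` y) <= size s + rho z + rho y)%N.
  elim: s z => /= [z ->|a s IH z [za /IH]]; first by rewrite joinxx; lia.
  case: za => c.
    by have := graded_le fl gr (leU2 (ltW (proj1 c)) (lexx y)); have := gr _ _ c; lia.
  have : (rho (z `|` y) <= (rho (a `|` y)).+1)%N.
    by have [->|/gr->] := covers_join y c.
  by have := gr _ _ c; lia.
(* The bound is attained by climbing from [x] to the join and then descending to [y]. *)
have [s1 [w1 /(_ _ gr) e1]] := le_walk fl (leUl x y).
have [s2 [/walk_sym[s3 [w3 sz]] /(_ _ gr) e2]] := le_walk fl (leUr y x).
suff -> : cdist x y = size (s1 ++ s3) by rewrite size_cat; lia.
apply: cdist_unique => //; first by exists (s1 ++ s3); split=> //; exact: walk_cat w1 w3.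
by move=> s /lower; rewrite size_cat; lia.
Qed.

End Semimodular.
End Covering.

(** * Breadth at most two *)

Lemma exists_notin (J : finType) (S : {set J}) : (#|S| < #|J|)%N -> exists k, k \notin S.
Proof.
rewrite -(cardsC S) -{1}[#|S|]addn0 ltn_add2l => /card_gt0P[k].
by rewrite inE; exists k.
Qed.

Lemma sum_add_const (A : eqType) (s : seq A) (F G : A -> nat) (a b : nat) :
  (forall x, x \in s -> (F x + a <= G x + b)%N) ->
  (\sum_(x <- s) F x + a * size s <= \sum_(x <- s) G x + b * size s)%N.
Proof.
elim: s => [|x s IH] H; first by rewrite !big_nil !muln0.
rewrite !big_cons /=.
have := H x (mem_head _ _).
have := IH (fun z zs => H z (mem_behead (s := x :: s) zs)).
by rewrite !mulnS; lia.
Qed.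

Section BreadthTwo.
Context {d : Order.disp_t} {T : tbLatticeType d}.
Hypotheses (fl : finite_length T) (usm : upper_semimodular T).
Implicit Types (x y z : T).

Lemma breadth_le2_triple (n : nat) (x : 'I_3 -> T) : has_breadth T n -> (n <= 2)%N ->
  exists k, x k <= \join_(i | i != k) x i.
Proof.
case=> [[H _] _|[_ [_ [bp _]]] n2]; first by exists ord0; rewrite (H (x ord0) \bot).
have [|S [cS jS]] := bp 3 x; first lia.
have [|k kS] := exists_notin (S := S); first by rewrite cS card_ord.
exists k; apply: le_trans (_ : \join_(i < 3) x i <= _); first exact: joins_sup.
rewrite -jS; apply/joinsP => i iS; apply: joins_sup.
by apply: contraNneq kS => <-.
Qed.

(** One of [y], [x1], [x2] is below the join of the other two, and it is not [y]. So the joins of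
    [y] with [x1] and with [x2] are comparable. *)
Lemma breadth_le2_comparable (n : nat) x1 x2 y : has_breadth T n -> (n <= 2)%N ->
  ~~ (y <= x1 `|` x2) -> (x1 <= y `|` x2) || (x2 <= y `|` x1).
Proof.
move=> hb n2 nle.
have [k] := breadth_le2_triple (fun i : 'I_3 => nth y [:: y; x1; x2] i) hb n2.
rewrite big_mkcond /= !big_ord_recl big_ord0 /=.
case: k => [[|[|[|//]]] ?]; rewrite /eq_op /= ?join0x ?joinx0 => H.
- by rewrite H in nle.
- by rewrite H.
- by rewrite H orbT.
Qed.

Lemma c1_ge (xi : seq T) x : x \in xi -> x <= c1 xi.
Proof. by move=> h; exact: joins_sup_seq. Qed.

Lemma breadth_le2_c1_median (n : nat) : has_breadth T n -> (n <= 2)%N ->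
  c1_median_property T.
Proof.
move=> hb n2 xi xi0 y my; apply/negPn/negP => yj.
have [rho gr] := semimodular_graded fl usm.
(* [e x x'] amounts to y v x <= y v x'; it is total on the profile since [y] is not below its
   join. *)
pose e x x' := x <= y `|` x'.
have etr : transitive e.
  by move=> x' x x'' h1 h2; apply: le_trans h1 _; rewrite leUx leUl.
have etot : {in xi &, total e}.
  move=> x x' hx hx'; apply: breadth_le2_comparable hb n2 _.
  by apply: contra yj => h; apply: le_trans h _; rewrite leUx !c1_ge.
pose s := sort e xi.
have ps : perm_eq xi s by rewrite perm_sym; exact/permEl/perm_sort.
have ss : pairwise e s.
  rewrite -(sorted_pairwise etr); apply: (sort_sorted_in etot); exact: allss.
have sz : size s = size xi by rewrite size_sort.
(* The middle index is rounded so that the part [t] before it has as many elements as the part [r]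
   after it, or one more. *)
have hn : ((size xi)./2 < size s)%N by rewrite sz; lia.
move: ss; rewrite -(cat_take_drop (size xi)./2 s) (drop_nth y hn).
have st : size (take (size xi)./2 s) = (size xi)./2 by rewrite size_take hn.
have sr : size (drop (size xi)./2.+1 s) = (size xi - (size xi)./2.+1)%N.
  by rewrite size_drop sz.
move: ps; rewrite -{1}(cat_take_drop (size xi)./2 s) (drop_nth y hn).
set t := take _ _ in st *; set r := drop _ _ in sr *; set x0 := nth _ _ _ => ps.
rewrite pairwise_cat pairwise_cons allrel_consr.
move=> /and3P[/andP[/allP tx0 _] _ /andP[/allP x0r _]].
have rE z : rdist z xi =
    (\sum_(x <- t) cdist z x + (cdist z x0 + \sum_(x <- r) cdist z x))%N.
  by rewrite /rdist (perm_big _ ps) big_cat big_cons.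
have x0xi : x0 \in xi by rewrite (perm_mem ps) mem_cat mem_head orbT.
pose w : T := y `|` x0; pose z : T := w `&` c1 xi.
have D := cdist_graded fl usm (rho := rho) _ _ gr.
have yw : (rho y <= rho w)%N by rewrite graded_le // leUl.
have zw : (rho z < rho w)%N.
  apply: graded_lt => //; rewrite lt_neqAle leIl andbT; apply: contraNneq yj => E.
  by apply: le_trans (leUl y x0) _; rewrite -/w -E leIr.
have := my z; rewrite !rE.
have xz x : x \in xi -> x <= w -> rho (z `|` x) = rho z.
  by move=> hx xw; rewrite join_l // lexI xw c1_ge.
have tx x : x \in t -> x \in xi by move=> h; rewrite (perm_mem ps) mem_cat h.
have up x : (rho y <= rho (y `|` x))%N by rewrite graded_le // leUl.
have Ht : (\sum_(x <- t) cdist z x + (rho w - rho z) * size t <=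
           \sum_(x <- t) cdist y x + (rho w - rho y) * size t)%N.
  apply: sum_add_const => x xt.
  by have := D z x; have := D y x; have := up x; rewrite (xz _ (tx _ xt) (tx0 _ xt)); lia.
have H0 : (cdist z x0 + (rho w - rho z) + (rho w - rho y) <= cdist y x0)%N.
  by have := D z x0; have := D y x0; rewrite -/w xz ?leUr //; lia.
have Hr : (\sum_(x <- r) cdist z x + (rho w - rho y) * size r <=
           \sum_(x <- r) cdist y x + (rho w - rho z) * size r)%N.
  apply: sum_add_const => x /x0r wx.
  have : (rho (z `|` x) <= rho (y `|` x))%N.
    by rewrite graded_le // leUx leUr (le_trans (leIl _ _)) // leUx leUl.
  by have := D z x; have := D y x; lia.
(* With a = rho w - rho z and b = rho w - rho y, the total distance drops by at least a + b or 2a in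
   the two cases for the sizes; b may be 0, but a is positive. *)
move: Ht H0 Hr; rewrite st sr; have : (0 < rho w - rho z)%N by lia.
move: (rho w - rho z)%N (rho w - rho y)%N => a b.
have : ((size xi)./2 = size xi - (size xi)./2.+1 \/
        (size xi)./2 = (size xi - (size xi)./2.+1).+1)%N by lia.
by move: ((size xi)./2) (size xi - _)%N => p q [] ->; rewrite ?mulnS; lia.
Qed.
End BreadthTwo.

(** * Irredundant joins *)

Section Irredundant.
Context {d : Order.disp_t} {T : tbLatticeType d}.

Definition irredundant (J : finType) (x : J -> T) : Prop :=
  forall k, ~~ (x k <= \join_(i | i != k) x i).

Lemma exists_card_superset (J : finType) (A : {set J}) (n : nat) :
  (#|A| <= n)%N -> (n <= #|J|)%N -> exists B : {set J}, A \subset B /\ #|B| = n.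
Proof.
elim: n => [|n IH]; first by rewrite leqn0 => /eqP A0 _; exists A.
rewrite leq_eqVlt => /orP[/eqP An _|An nJ]; first by exists A.
have [B [AB Bn]] := IH An (ltnW nJ).
have [|k kB] := exists_notin (S := B); first by rewrite Bn.
exists (k |: B); split; last by rewrite cardsU1 kB Bn.
exact: subset_trans AB (subsetU1 _ _).
Qed.

(** A set of [n] indices with the full join misses an index of a larger family, whose member is then
    redundant. Conversely, a smallest index set with the full join is irredundant, and it can be
    padded to exactly [n] indices. *)
Lemma breadth_propP (n : nat) :
  breadth_prop T n <->
  forall (J : finType) (x : J -> T), irredundant x -> (#|J| <= n)%N.
Proof.
split=> [bp J x irr|H m x nm].
  rewrite leqNgt; apply/negP => nJ.
  have [S [Sn jS]] := bp _ (fun i => x (enum_val i)) (ltnW nJ).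
  have [|k kS] := exists_notin (S := S); first by rewrite Sn card_ord.
  have /negP := irr (enum_val k); apply.
  apply: le_trans (_ : \join_i x (enum_val i) <= _).
    exact: (joins_sup (fun i => x (enum_val i))).
  rewrite -jS; apply/joinsP => i iS; apply: (joins_sup x).
  by apply: contraNneq kS => /enum_val_inj <-.
have [|A /eqP jA Amin] := @arg_minnP _ [set: 'I_m]
    (fun A : {set 'I_m} => \join_(i in A) x i == \join_i x i) (fun A => #|A|).
  by apply/eqP/eq_bigl => i; rewrite inE.
have cA : (#|A| <= n)%N.
  have <- : #|{: {i | i \in A}}| = #|A| by rewrite card_sig; apply: eq_card.
  apply: (H _ (fun i => x (val i))) => -[k kA] /=.
  apply/negP => le.
  have /Amin : \join_(i in A :\ k) x i == \join_i x i.
    rewrite eq_le; apply/andP; split; first by apply/joinsP => i _; exact: joins_sup.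
    rewrite -jA; apply/joinsP => i iA.
    have [->|ik] := eqVneq i k; last by apply: joins_sup; rewrite !inE ik.
    apply: le_trans le _; apply/joinsP => -[j jA'] /= jk; apply: joins_sup.
    by rewrite !inE jA' andbT; apply: contraNneq jk => E; apply/eqP/val_inj.
  by rewrite (cardsD1 k A) kA ltnn.
have [|B [AB Bn]] := exists_card_superset cA; first by rewrite card_ord.
exists B; split=> //; apply/eqP; rewrite eq_le; apply/andP; split.
  by apply/joinsP => i _; exact: joins_sup.
by rewrite -jA; apply/joinsP => i /(subsetP AB) iB; exact: joins_sup.
Qed.

Lemma breadth_prop0 : breadth_prop T 0 -> forall x y : T, x = y.
Proof.
move=> /breadth_propP H.
have top0 : (\top : T) <= \bot.
  apply/negPn/negP => nle; have := H unit (fun=> \top); rewrite card_unit => K.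
  by suff /K : irredundant (fun _ : unit => (\top : T)); last by
    case; rewrite big_pred0 // => -[].
have all0 x : x = \bot :> T by apply/eqP; rewrite -lex0; exact: le_trans (lex1 x) top0.
by move=> x y; rewrite (all0 x) (all0 y).
Qed.

(** This form treats the singleton lattice together with the others: there the empty family is the
    largest irredundant one. *)
Lemma has_breadthP (n : nat) :
  has_breadth T n <->
  breadth_prop T n /\ exists (J : finType) (x : J -> T), irredundant x /\ #|J| = n.
Proof.
split.
- case=> [[H ->]|[[a [b ab]] [n0 [bp bmin]]]].
    split; last by exists 'I_0, (fun=> \bot); split; [case|rewrite card_ord].
    apply/breadth_propP => J x irr; rewrite leqn0; apply/eqP/eq_card0 => k.
    by have := irr k; rewrite [x k](H _ \bot) le0x.
  (* For [n = 1] minimality says nothing about [n.-1 = 0], so nontriviality of the lattice is used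
     instead. *)
  split=> //; have bp' : ~ breadth_prop T n.-1.
    have [/eqP n1|n1] := boolP (n.-1 == 0).
      by rewrite n1 => /breadth_prop0 /(_ a b).
    by move=> /(bmin _ _); rewrite lt0n => /(_ n1); lia.
  have [J nJ] : exists J : finType, ~ forall x : J -> T, irredundant x -> (#|J| <= n.-1)%N.
    by apply: not_all_ex_not => H; apply: bp'; apply/breadth_propP.
  have [x nx] := not_all_ex_not _ _ nJ.
  have [irr le] := imply_to_and _ _ nx.
  exists J, x; split=> //; have := (proj1 (breadth_propP n) bp) _ _ irr.
  by move: le => /negP; lia.
- move=> [bp [J [x [irr cJ]]]].
  have [n0|n0] := posnP n.
    by left; split=> //; apply: breadth_prop0; rewrite -n0.
  right; split.
    have /card_gt0P[k _] : (0 < #|J|)%N by rewrite cJ.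
    exists (x k), (\join_(i | i != k) x i) => E.
    by have := irr k; rewrite -E lexx.
  split=> //; split=> // n' _ /breadth_propP /(_ _ _ irr); by rewrite cJ.
Qed.

End Irredundant.

(** * Direct products *)

Section Product.
Context {I : finType} {dL : I -> Order.disp_t} {L : forall i, tbLatticeType (dL i)}.
Local Notation P := (dprodL L).
Implicit Types (f g h : P).

Lemma dprod_leP f g : reflect (forall i, f i <= g i) (f <= g).
Proof. exact: forallP. Qed.

Lemma dprod_joinE f g i : (f `|` g) i = f i `|` g i.
Proof. by rewrite ffunE. Qed.

Lemma dprod_meetE f g i : (f `&` g) i = f i `&` g i.
Proof. by rewrite ffunE. Qed.

Lemma dprod_botE i : (\bot : P) i = \bot.
Proof. by rewrite ffunE. Qed.

Lemma dprod_joinsE (J : Type) (r : seq J) (p : pred J) (x : J -> P) i :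
  (\join_(j <- r | p j) x j) i = \join_(j <- r | p j) x j i.
Proof.
apply: (big_morph (fun f : P => f i)) => [f g|]; [exact: dprod_joinE|exact: dprod_botE].
Qed.

Definition upd f i (a : L i) : P := finfun (dfwith f a).

Lemma upd_in f i (a : L i) : upd f a i = a.
Proof. by rewrite ffunE dfwith_in. Qed.

Lemma upd_out f i (a : L i) j : j != i -> upd f a j = f j.
Proof. by move=> ji; rewrite ffunE dfwith_out // eq_sym. Qed.

Lemma eq_upd f g i : (forall j, j != i -> f j = g j) -> g = upd f (g i).
Proof.
move=> H; apply/ffunP => j.
by have [->|ji] := eqVneq j i; [rewrite upd_in|rewrite upd_out // H].
Qed.

Lemma dprod_ltW f g i : (forall j, j != i -> f j = g j) -> (f < g) = (f i < g i).
Proof.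
move=> H; rewrite !lt_neqAle; congr andb.
  by congr negb; apply/eqP/eqP => [->//|E]; apply/ffunP => j;
    have [->|/H] := eqVneq j i.
apply/dprod_leP/idP => [//|le] j.
by have [->|/H->] := eqVneq j i.
Qed.

(** If [f i < g i], raising [f] to [g] in coordinate [i] alone gives an element above [f] and at
    most [g], which is [g] by the covering. *)
Lemma covers_dprodP f g :
  covers f g <-> exists i, covers (f i) (g i) /\ forall j, j != i -> f j = g j.
Proof.
split=> [[fg c]|[i [[fg c] H]]].
  have /dprod_leP le := ltW fg.
  have [i fgi] : exists i, f i < g i.
    apply: NNPP => nlt; have := fg; suff -> : f = g by rewrite ltxx.
    apply/ffunP => i; apply/eqP; rewrite eq_le le /=; apply/negPn/negP => nle.
    by apply: nlt; exists i; rewrite lt_leAnge le.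
  have E : upd f (g i) = g.
    apply/eqP/negPn/negP => neq; apply: (c (upd f (g i))); split.
      by rewrite (@dprod_ltW _ _ i) ?upd_in // => j ji; rewrite upd_out.
    rewrite lt_neqAle neq; apply/dprod_leP => j.
    by have [->|ji] := eqVneq j i; [rewrite upd_in|rewrite upd_out].
  have H j : j != i -> f j = g j by move=> ji; rewrite -E upd_out.
  exists i; split=> //; split=> // z [fz zg]; apply: (c (upd f z)).
  rewrite (@dprod_ltW f _ i) ?(@dprod_ltW _ g i) ?upd_in //.
    by move=> j ji; rewrite upd_out ?H.
  by move=> j ji; rewrite upd_out.
split; first by rewrite (dprod_ltW H).
move=> z [fz zg].
have zE j : j != i -> f j = z j.
  move=> ji; apply/eqP; rewrite eq_le (dprod_leP _ _ (ltW fz)) (H _ ji).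
  exact: (dprod_leP _ _ (ltW zg)).
apply: (c (z i)); rewrite -(dprod_ltW zE) -(@dprod_ltW z g i) // => j ji.
by rewrite -zE ?H.
Qed.

(** Away from the coordinate [i] where the covering takes place, [f] lies below [g], so the join
    agrees with [g] there. *)
Lemma upper_semimodular_dprod :
  (forall i, upper_semimodular (L i)) -> upper_semimodular P.
Proof.
move=> usm f g /covers_dprodP[i [ci H]]; apply/covers_dprodP; exists i; split.
  by rewrite dprod_joinE; apply: usm; rewrite -dprod_meetE.
by move=> j /H; rewrite dprod_meetE dprod_joinE => /meet_idPl/join_r.
Qed.

Lemma finite_length_dprod : (forall i, finite_length (L i)) -> finite_length P.
Proof.
move=> fl; have /fin_all_exists[h hP] i := finite_length_rank (fl i).
have /fin_all_exists[n hn] := hP.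
apply: (@finite_length_of_rank _ P (fun f => \sum_i h i (f i))%N (\sum_i n i)%N).
  move=> f g fg; have /dprod_leP le := ltW fg.
  have hle i : (h i (f i) <= h i (g i))%N.
    have := le i; rewrite le_eqVlt => /orP[/eqP->//|].
    by move=> /(proj1 (hn i)); exact: ltnW.
  rewrite ltn_neqAle leq_sum // andbT; apply: contraTneq fg => E.
  suff -> : f = g by rewrite ltxx.
  apply/ffunP => i; apply/eqP/negPn/negP => neq.
  have : (h i (f i) < h i (g i))%N.
    by apply: (proj1 (hn i)); rewrite lt_neqAle neq le.
  have : (\sum_(j | j != i) h j (f j) <= \sum_(j | j != i) h j (g j))%N by exact: leq_sum.
  by move: E; rewrite (bigD1 i) //= [in RHS](bigD1 i) //=; lia.
by move=> f; apply: leq_sum => i _; exact: (proj2 (hn i)).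
Qed.

(** * Distances and medians in a product *)

Section Distance.
Hypothesis fl : forall i, finite_length (L i).

Let flP := finite_length_dprod fl.

Lemma walk_upd f i (a b : L i) s : walk a s b -> walk (upd f a) (map (upd f (i:=i)) s) (upd f b).
Proof.
elim: s a => /= [a ->//|c s IH a [ac /IH w]]; split=> //.
by case: ac => ac; [left|right]; apply/covers_dprodP; exists i; rewrite !upd_in;
  split=> // j ji; rewrite !upd_out.
Qed.

Lemma cdist_dprod f g : cdist f g = (\sum_i cdist (f i) (g i))%N.
Proof.
apply: cdist_unique => //.
  (* A walk of this length corrects the differing coordinates one at a time, each along a shortest
     walk in its factor. *)
  have [n] := ubnP #|[pred i | f i != g i]|; elim: n f => // n IH f hn.
  have [/existsP[i neq]|/existsPn H] := boolP [exists i, f i != g i].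
    have [|s [w sz]] := IH (upd f (g i)).
      apply: leq_trans (_ : #|[pred i | f i != g i]| <= n)%N; last exact: hn.
      apply: proper_card; apply/properP; split.
        apply/subsetP => j; rewrite !inE.
        by have [->|ji] := eqVneq j i; [rewrite upd_in eqxx|rewrite upd_out].
      by exists i; rewrite !inE ?upd_in ?eqxx.
    have [[t [wt st]] _] := cdistP (f i) (g i) (fl i).
    have := walk_upd f wt; rewrite -(@eq_upd f f i) // => wt'.
    exists (map (upd f (i:=i)) t ++ s); split; first exact: walk_cat wt' w.
    rewrite size_cat size_map sz st [RHS](bigD1 i) //= [X in (_ + X)%N](bigD1 i) //=.
    rewrite upd_in cdistxx // add0n; congr addn.
    by apply: eq_bigr => j ji; rewrite upd_out.
  have -> : f = g by apply/ffunP => i; apply/eqP; have := H i; rewrite negbK.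
  by exists [::]; split=> //; rewrite big1 // => i _; exact: cdistxx.
(* No walk is shorter: an edge moves a single coordinate, so it changes the sum by at most one. *)
move=> s; elim: s f => /= [f ->|z s IH f [fz /IH le]].
  by rewrite big1 // => i _; exact: cdistxx.
have [i [adj H]] : exists i, cg_adj (f i) (z i) /\ forall j, j != i -> f j = z j.
  case: fz => /covers_dprodP[i [c H]]; exists i; split=> //; [by left| by right|].
  by move=> j /H.
apply: leq_trans (_ : (\sum_i cdist (z i) (g i)).+1 <= _)%N => //.
rewrite (bigD1 i) //= [in leqRHS](bigD1 i) //= -addSn leq_add ?cdist_adj //.
by apply: leq_sum => j ji; rewrite H.
Qed.

Lemma rdist_dprod f (xi : seq P) : rdist f xi = (\sum_i rdist (f i) [seq x i | x : P <- xi])%N.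
Proof.
rewrite /rdist; under eq_bigr do rewrite cdist_dprod.
by rewrite exchange_big; apply: eq_bigr => i _; rewrite big_map.
Qed.

Lemma c1_dprod (xi : seq P) i : c1 xi i = c1 [seq x i | x : P <- xi].
Proof. by rewrite /c1 dprod_joinsE big_map. Qed.

(** Compare [f] with its modifications in coordinate [i] only: the terms of the other coordinates
    cancel. *)
Lemma is_median_proj (xi : seq P) f i :
  is_median xi f -> is_median [seq x i | x : P <- xi] (f i).
Proof.
move=> fm z; have := fm (upd f z); rewrite !rdist_dprod.
rewrite (bigD1 i) //= [in leqRHS](bigD1 i) //= upd_in.
rewrite [X in (_ <= _ + X)%N](_ : _ = \sum_(j | j != i) rdist (f j) [seq x j | x : P <- xi])%N.
  by rewrite leq_add2r.
by apply: eq_bigr => j ji; rewrite upd_out.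
Qed.

Lemma c1_median_dprod : (forall i, c1_median_property (L i)) -> c1_median_property P.
Proof.
move=> cm xi xi0 f fm; apply/dprod_leP => i; rewrite c1_dprod.
by apply: cm; [rewrite size_map|exact: is_median_proj].
Qed.

(* Away from [i], a profile and a candidate concentrated at [\bot] contribute nothing. *)
Lemma c1_median_factor i : c1_median_property P -> c1_median_property (L i).
Proof.
move=> cm xi xi0 y ym; pose e : L i -> P := upd \bot (i:=i).
have eE : [seq x i | x : P <- map e xi] = xi.
  by rewrite -map_comp map_id_in // => x _ /=; rewrite upd_in.
suff em : is_median (map e xi) (e y).
  have := cm (map e xi); rewrite size_map => /(_ xi0 _ em) /dprod_leP/(_ i).
  by rewrite c1_dprod eE upd_in.
move=> z; rewrite !rdist_dprod (bigD1 i) //= big1 ?addn0 => [|j ji].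
  by rewrite (bigD1 i) //= eE upd_in (leq_trans (ym (z i))) // leq_addr.
rewrite /rdist big_map big_map big1 // => x _.
by rewrite !upd_out // cdistxx.
Qed.

End Distance.

Lemma has_breadth_dprod (b : I -> nat) :
  (forall i, has_breadth (L i) (b i)) -> has_breadth P (\sum_i b i)%N.
Proof.
move=> hb; apply/has_breadthP; split.
  apply/breadth_propP => J x irr.
  have ex k : exists i, ~~ (x k i <= \join_(j | j != k) x j i).
    have := irr k; rewrite -[X in _ <= X]/(\join_(j | j != k) x j).
    move=> /dprod_leP H; apply: NNPP => H'; apply: H => i; apply/negPn/negP => h.
    by apply: H'; exists i; rewrite -dprod_joinsE.
  (* The members that [c] assigns to a coordinate [i] form an irredundant family in [L i], so there
     are at most [b i] of them. *)
  have [c cP] := fin_all_exists ex.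
  rewrite -sum1_card (partition_big c xpredT) //=; apply: leq_sum => i _.
  rewrite sum1_card.
  have <- : #|{: {k | c k == i}}| = #|[pred k | c k == i]| by rewrite card_sig.
  have [/breadth_propP bp _] := proj1 (has_breadthP _) (hb i).
  apply: (bp _ (fun k => x (val k) i)) => -[k kc] /=; have /eqP ki := kc.
  move: (cP k); rewrite ki; apply: contra => /le_trans; apply.
  apply/joinsP => -[j cj] /= jk; apply: (joins_sup (fun j => x j i)).
  by apply: contraNneq jk => E; apply/eqP/val_inj.
have /fin_all_exists[J hJ] i := proj2 (proj1 (has_breadthP _) (hb i)).
have /fin_all_exists[x xP] := hJ.
(* The bound is attained by the disjoint union of largest irredundant families of the factors, each
   placed in its own coordinate with [\bot] elsewhere. *)
exists {i : I & J i}, (fun k => upd \bot (x (tag k) (tagged k))); split.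
  case=> i k /=; apply/negP => /dprod_leP/(_ i).
  rewrite upd_in dprod_joinsE; apply/negP.
  have [irr _] := xP i; move: (irr k); apply: contra => /le_trans; apply.
  apply/joinsP => -[i' k'] /= neq.
  have [E|ii'] := eqVneq i i'; last by rewrite upd_out // dprod_botE le0x.
  subst i'; rewrite upd_in; apply: joins_sup.
  by apply: contraNneq neq => ->.
rewrite card_tagged sumnE big_map big_enum; apply: eq_bigr => i _.
by case: (xP i).
Qed.

End Product.

(** * A lattice of breadth three *)

(* [rk] is a submodular function on the product of chains [0..4] x [0..6] x [0..6] that increases
   by at most one at each step; the lattice consists of its 129 flats, the elements at which every
   step increases [rk]. The profile (0,6,0), (0,0,6), (0,0,0) has the median (4,0,0), while its join is
   (0,6,6). *)
Definition triple : Type := nat * nat * nat.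

Definition rk (p : triple) : nat :=
  let: (a, b, c) := p in minn (minn (a + b + c) (9 + minn a 1)) (7 + minn b c).

Definition le3 (p q : triple) : bool :=
  [&& p.1.1 <= q.1.1, p.1.2 <= q.1.2 & p.2 <= q.2]%N.
Definition min3 (p q : triple) : triple :=
  (minn p.1.1 q.1.1, minn p.1.2 q.1.2, minn p.2 q.2).
Definition max3 (p q : triple) : triple :=
  (maxn p.1.1 q.1.1, maxn p.1.2 q.1.2, maxn p.2 q.2).

Lemma lt_step (p q : triple) : le3 p q -> p != q ->
  exists r, [/\ le3 p r, p != r, le3 r q & (rk r <= (rk p).+1)%N].
Proof.
case: p q => [[a b] c] [[a' b'] c']; rewrite /le3 /= => /and3P[ha hb hc] neq.
have [lt|ea] := ltnP a a'; first by exists (a.+1, b, c); rewrite !xpair_eqE /rk /=; split; lia.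
have [lt|eb] := ltnP b b'; first by exists (a, b.+1, c); rewrite !xpair_eqE /rk /=; split; lia.
have [lt|ec] := ltnP c c'; first by exists (a, b, c.+1); rewrite !xpair_eqE /rk /=; split; lia.
by case/eqP: neq; congr (_, _, _); lia.
Qed.

Definition box (p : triple) : bool := le3 p (4, 6, 6).
Definition grid : seq triple :=
  [seq (ab, c) | ab <- [seq (a, b) | a <- iota 0 5, b <- iota 0 7], c <- iota 0 7].

Definition step (f : triple -> triple) (p : triple) : triple :=
  if box (f p) && (rk (f p) == rk p) then f p else p.
Definition succ1 (p : triple) : triple := (p.1.1.+1, p.1.2, p.2).
Definition succ2 (p : triple) : triple := (p.1.1, p.1.2.+1, p.2).
Definition succ3 (p : triple) : triple := (p.1.1, p.1.2, p.2.+1).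
(* By submodularity of [rk], a step that is not free stays so after free steps in other
   directions; hence a single pass reaches the closure. *)
Definition cl (p : triple) : triple :=
  iter 6 (step succ3) (iter 6 (step succ2) (iter 4 (step succ1) p)).

(* Locked, as unification would otherwise try to enumerate this list. *)
Definition flats : seq triple := locked [seq p <- grid | cl p == p].

Lemma mem_grid p : (p \in grid) = box p.
Proof.
rewrite /box /le3; apply/idP/and3P.
  case/allpairsP => -[ab c] [/allpairsP[[a b] [ha hb ->]] hc ->].
  by move: ha hb hc; rewrite !mem_iota /=; split; lia.
case: p => [[a b] c] [ha hb hc]; apply/allpairsP; exists ((a, b), c); split=> //.
  by apply/allpairsP; exists (a, b); rewrite !mem_iota; split.
by rewrite mem_iota.
Qed.

Lemma cl_spec : all (fun p => let q := cl p in
  [&& box q, cl q == q, le3 p q & rk q == rk p]) grid.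
Proof. by vm_compute. Qed.

(** With [cl_spec] this makes [cl p] the least flat above [p], so the join of two flats is the
    closure of their coordinatewise maximum. *)
Lemma cl_le : all (fun p => let q := cl p in all (fun r => le3 p r ==> le3 q r) flats) grid.
Proof. by rewrite /flats -lock; vm_compute. Qed.

Lemma rk_flats_lt :
  all (fun p => all (fun q => le3 p q ==> (p != q) ==> (rk p < rk q)%N) flats) flats.
Proof. by rewrite /flats -lock; vm_compute. Qed.

(** The maximum of two flats need not be a flat, but its closure has the same rank; hence the rank
    is submodular on the lattice of flats. *)
Lemma rk_submodular :
  all (fun p => all (fun q => rk (max3 p q) + rk (min3 p q) <= rk p + rk q)%N flats) flats.
Proof. by rewrite /flats -lock; vm_compute. Qed.

(** For a flat [p], the distance formula makes this the total distance from [p] to the profile, plus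
    [3 * rk p], plus a constant depending on the profile alone. *)
Definition rk_sum (p : triple) : nat :=
  2 * rk (max3 p (0, 6, 0)) + 2 * rk (max3 p (0, 0, 6)) + 2 * rk (max3 p (0, 0, 0)).

(** The median property of [(4, 0, 0)] in a form free of subtraction. *)
Lemma rk_sum_min :
  all (fun p => rk_sum (4, 0, 0) + 3 * rk p <= rk_sum p + 3 * rk (4, 0, 0))%N flats.
Proof. by rewrite /flats -lock; vm_compute. Qed.

Local Opaque cl grid rk.

Lemma le3_refl : reflexive le3.
Proof. by move=> p; rewrite /le3 !leqnn. Qed.

Lemma le3_anti : antisymmetric le3.
Proof.
move=> [[a b] c] [[a' b'] c'] /andP[/and3P[/= h1 h2 h3] /and3P[/= h4 h5 h6]].
by congr (_, _, _); lia.
Qed.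

Lemma le3_trans : transitive le3.
Proof. by move=> q p r; rewrite /le3; lia. Qed.

Lemma le3_min p q r : le3 p (min3 q r) = le3 p q && le3 p r.
Proof. by rewrite /le3 /min3 /=; lia. Qed.

Lemma le3_max p q r : le3 (max3 p q) r = le3 p r && le3 q r.
Proof. by rewrite /le3 /max3 /=; lia. Qed.

Lemma box_max p q : box p -> box q -> box (max3 p q).
Proof. by rewrite /box le3_max => -> ->. Qed.

Lemma box_min p q : box p -> box (min3 p q).
Proof. by apply: le3_trans; have := le3_refl (min3 p q); rewrite le3_min => /andP[]. Qed.

Lemma flatP p : p \in flats = box p && (cl p == p).
Proof. by rewrite /flats -lock mem_filter mem_grid andbC. Qed.

Lemma clP p : box p -> [/\ cl p \in flats, le3 p (cl p) & rk (cl p) = rk p].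
Proof.
by rewrite -mem_grid => /(allP cl_spec)/and4P[h1 h2 -> /eqP]; rewrite flatP h1.
Qed.

Lemma cl_min p r : box p -> r \in flats -> le3 (cl p) r = le3 p r.
Proof.
move=> bp rf; apply/idP/idP; first by apply: le3_trans; case: (clP bp).
by have := bp; rewrite -mem_grid => /(allP cl_le)/allP/(_ r rf)/implyP.
Qed.

(** The closure of the minimum is the least flat above it, hence below both [p] and [q], hence the
    minimum itself. *)
Lemma flat_min p q : p \in flats -> q \in flats -> min3 p q \in flats.
Proof.
move=> pf qf; have bp : box p by move: pf; rewrite flatP => /andP[].
have bm := box_min q bp; rewrite flatP bm; apply/eqP/le3_anti.
have [_ H _] := clP bm.
rewrite H.
rewrite andbT.
rewrite le3_min.
rewrite (cl_min bm pf) (cl_min bm qf).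
rewrite -le3_min.
exact: le3_refl.
Qed.

(** * The flats as an upper semimodular lattice *)

Definition flat : Type := seq_sub flats.
HB.instance Definition _ := Finite.on flat.

Implicit Types x y z : flat.

Lemma flat_box x : box (ssval x).
Proof. by have := ssvalP x; rewrite flatP => /andP[]. Qed.

Definition flat_le x y : bool := le3 (ssval x) (ssval y).

Lemma flat_le_refl : reflexive flat_le.
Proof. by move=> x; exact: le3_refl. Qed.
Lemma flat_le_anti : antisymmetric flat_le.
Proof. by move=> x y /le3_anti/val_inj. Qed.
Lemma flat_le_trans : transitive flat_le.
Proof. by move=> y x z; exact: le3_trans. Qed.

HB.instance Definition _ := Order.isPOrder.Build (Order.Disp tt tt) flat
  (fun _ _ => erefl) flat_le_refl flat_le_anti flat_le_trans.

Lemma flat_max_proof x y : cl (max3 (ssval x) (ssval y)) \in flats.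
Proof. by have [] := clP (box_max (flat_box x) (flat_box y)). Qed.

Definition flat_meet x y : flat := SeqSub (flat_min (ssvalP x) (ssvalP y)).
Definition flat_join x y : flat := SeqSub (flat_max_proof x y).

Lemma flat_meetP x y z : (x <= flat_meet y z) = (x <= y) && (x <= z).
Proof. exact: le3_min. Qed.

Lemma flat_joinP x y z : (flat_join x y <= z) = (x <= z) && (y <= z).
Proof.
rewrite -le3_max -(cl_min _ (ssvalP z)) //; apply: box_max; exact: flat_box.
Qed.

HB.instance Definition _ := Order.POrder_MeetJoin_isLattice.Build (Order.Disp tt tt)
  flat flat_meetP flat_joinP.

Definition flat_of (p : triple) (pf : p \in flats) : flat := SeqSub pf.

Lemma flat_ofK (p : triple) (pf : p \in flats) : ssval (flat_of pf) = p.
Proof. by []. Qed.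

Lemma zero_flat : (0, 0, 0) \in flats. Proof. by rewrite flatP; vm_compute. Qed.
Lemma top_flat : (4, 6, 6) \in flats. Proof. by rewrite flatP; vm_compute. Qed.

Lemma flat_le0x x : flat_of zero_flat <= x.
Proof. by []. Qed.
Lemma flat_lex1 x : x <= flat_of top_flat.
Proof. exact: flat_box. Qed.

HB.instance Definition _ := Order.hasBottom.Build (Order.Disp tt tt) flat flat_le0x.
HB.instance Definition _ := Order.hasTop.Build (Order.Disp tt tt) flat flat_lex1.

Lemma flat_leE x y : (x <= y) = le3 (ssval x) (ssval y).
Proof. by []. Qed.

Definition frk x : nat := rk (ssval x).

Lemma frk_lt x y : x < y -> (frk x < frk y)%N.
Proof.
rewrite lt_neqAle => /andP[neq le].
by have /allP/(_ _ (ssvalP x))/allP/(_ _ (ssvalP y))/implyP/(_ le)/implyP := rk_flats_lt; exact.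
Qed.

Lemma frk_join x y : frk (x `|` y) = rk (max3 (ssval x) (ssval y)).
Proof. by have [] := clP (box_max (flat_box x) (flat_box y)). Qed.

Lemma frk_submodular x y : (frk (x `|` y) + frk (x `&` y) <= frk x + frk y)%N.
Proof.
rewrite frk_join.
exact: (allP (allP rk_submodular _ (ssvalP x)) _ (ssvalP y)).
Qed.

(** A unit step from [x] towards [y] raises [rk] by at most one. Its closure has the same rank and
    is a flat strictly above [x] and at most [y], hence equal to [y]. *)
Lemma frk_graded : graded frk.
Proof.
move=> x y [lt c]; have := lt; rewrite lt_neqAle => /andP[neq le].
have [|r [pr npr rq rkr]] := lt_step le; first exact: neq.
have br : box r by apply: le3_trans rq (flat_box y).
have [fr ler err] := clP br.
have [z zE] : exists z : flat, ssval z = cl r by exists (flat_of fr); exact: flat_ofK.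
have zy : z <= y by rewrite flat_leE zE (cl_min br (ssvalP y)).
have xz : x < z.
  rewrite lt_neqAle; apply/andP; split; last first.
    by rewrite flat_leE zE; exact: le3_trans pr ler.
  apply: contraNneq npr => E; apply/eqP/le3_anti; rewrite pr /=.
  by rewrite E zE.
have -> : y = z.
  by apply/eqP/negPn/negP => nyz; apply: (c z); split=> //; rewrite lt_neqAle eq_sym nyz zy.
by apply/eqP; rewrite eqn_leq frk_lt // andbT /frk zE err.
Qed.

(** By submodularity the rank of the join exceeds that of [y] by at most one, so no flat fits
    strictly between. *)
Lemma upper_semimodular_flat : upper_semimodular flat.
Proof.
move=> x y c.
have le : (frk (x `|` y) <= (frk y).+1)%N.
  have := frk_submodular x y; rewrite (frk_graded c) addSnnS addnC leq_add2l.
  exact.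
split.
  rewrite lt_neqAle leUr andbT; apply: contraTneq (proj1 c) => E.
  by rewrite E joinKI ltxx.
by move=> z [/frk_lt h1 /frk_lt/leq_trans/(_ le)]; rewrite ltnS leqNgt h1.
Qed.

Lemma finite_length_fin (d : Order.disp_t) (T : finTBLatticeType d) : finite_length T.
Proof.
exists #|T| => s ss; apply: leqW.
have us : uniq s by apply: sorted_uniq ss; [exact: lt_trans|exact: ltxx].
by rewrite -(card_uniqP us) max_card.
Qed.

Lemma flat_breadth_prop : breadth_prop flat 3.
Proof.
apply/breadth_propP => J x irr; rewrite leqNgt; apply/negP => J4.
have [k0 _] : exists k0 : J, true.
  by have /card_gt0P[k _] : (0 < #|J|)%N; [lia|exists k].
(* Three joinands attaining the maximal coordinates dominate all the others. *)
have max_coord (f : flat -> nat) : exists i, forall k, (f (x k) <= f (x i))%N.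
  by case: (@arg_maxnP _ k0 xpredT (fun k => f (x k))) => // i _ H; exists i => k; exact: H.
have [i1 H1] := max_coord (fun x => (ssval x).1.1).
have [i2 H2] := max_coord (fun x => (ssval x).1.2).
have [i3 H3] := max_coord (fun x => (ssval x).2).
have [|k] := exists_notin (S := [set i1; i2; i3]).
  by apply: leq_ltn_trans J4; rewrite !cardsU !cards1; lia.
rewrite !inE !negb_or => /andP[/andP[k1 k2] k3].
have := irr k; rewrite flat_leE.
set j := \join_(i | i != k) x i.
have le i : k != i -> le3 (ssval (x i)) (ssval j).
  by move=> ki; rewrite -flat_leE; apply: joins_sup; rewrite eq_sym.
have := le _ k1; have := le _ k2; have := le _ k3.
have := H1 k; have := H2 k; have := H3 k; rewrite /le3 /=.
move=> h3 h2 h1 /and3P[_ _ g3] /and3P[_ g2 _] /and3P[g1 _ _] /negP; apply.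
by rewrite (leq_trans h1 g1) (leq_trans h2 g2) (leq_trans h3 g3).
Qed.

Lemma flat_e1 : (1, 0, 0) \in flats. Proof. by rewrite flatP; vm_compute. Qed.
Lemma flat_e2 : (0, 1, 0) \in flats. Proof. by rewrite flatP; vm_compute. Qed.
Lemma flat_e3 : (0, 0, 1) \in flats. Proof. by rewrite flatP; vm_compute. Qed.
Lemma flat_e23 : (0, 1, 1) \in flats. Proof. by rewrite flatP; vm_compute. Qed.
Lemma flat_e13 : (1, 0, 1) \in flats. Proof. by rewrite flatP; vm_compute. Qed.
Lemma flat_e12 : (1, 1, 0) \in flats. Proof. by rewrite flatP; vm_compute. Qed.

Lemma flat_has_breadth : has_breadth flat 3.
Proof.
apply/has_breadthP; split; first exact: flat_breadth_prop.
pose x (i : 'I_3) := nth \bot [:: flat_of flat_e1; flat_of flat_e2; flat_of flat_e3] i.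
(* [u k] bounds the two members other than [x k] but not [x k], which avoids computing their
   join. *)
pose u (i : 'I_3) := nth \bot [:: flat_of flat_e23; flat_of flat_e13; flat_of flat_e12] i.
exists 'I_3, x; split; last by rewrite card_ord.
move=> k; have : ~~ (x k <= u k) by case: k => [[|[|[|//]]] ?].
apply: contra => h; apply: le_trans h _; apply/joinsP => i; rewrite -val_eqE /x /u.
by case: k i => [[|[|[|//]]] ?] [[|[|[|//]]] ?].
Qed.

Lemma flat_060 : (0, 6, 0) \in flats. Proof. by rewrite flatP; vm_compute. Qed.
Lemma flat_006 : (0, 0, 6) \in flats. Proof. by rewrite flatP; vm_compute. Qed.
Lemma flat_066 : (0, 6, 6) \in flats. Proof. by rewrite flatP; vm_compute. Qed.
Lemma flat_400 : (4, 0, 0) \in flats. Proof. by rewrite flatP; vm_compute. Qed.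

Lemma flat_not_c1_median : ~ c1_median_property flat.
Proof.
pose x1 := flat_of flat_060; pose x2 := flat_of flat_006; pose y := flat_of flat_400.
move=> /(_ [:: x1; x2; flat_of zero_flat] erefl y).
have D (s t : flat) : (cdist s t + frk s + frk t = 2 * frk (s `|` t))%N.
  exact: (cdist_graded (finite_length_fin flat) upper_semimodular_flat _ _ frk_graded).
have rE (z : flat) : (rdist z [:: x1; x2; flat_of zero_flat] + 3 * frk z +
    (frk x1 + frk x2 + frk (flat_of zero_flat)) = rk_sum (ssval z))%N.
  rewrite /rdist !big_cons big_nil /rk_sum.
  have := D z x1; have := D z x2; have := D z (flat_of zero_flat).
  rewrite !frk_join /x1 /x2 !flat_ofK. lia.
move=> cm; suff : is_median [:: x1; x2; flat_of zero_flat] y.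
  (* The flat [(0, 6, 6)] bounds the profile, hence its join, but not [y]. *)
  move=> /cm; apply/negP; have : ~~ (y <= flat_of flat_066) by [].
  apply: contra => /le_trans; apply.
  by rewrite /c1 !big_cons big_nil !leUx le0x.
move=> z; have := rE z; have := rE y; have := allP rk_sum_min _ (ssvalP z).
by rewrite /frk /y !flat_ofK; lia.
Qed.

(** * Raising the breadth with two-element chains *)

Lemma bool_upper_semimodular : upper_semimodular bool.
Proof.
by move=> [] [] [] //= _ _; split=> // -[] [].
Qed.

Lemma bool_has_breadth : has_breadth bool 1.
Proof.
apply/has_breadthP; split.
  apply/breadth_propP => J x irr; apply/card_le1P => k _ l.
  have kT : x k = true by have := irr k; case: (x k); rewrite ?le0x.
  rewrite !inE; apply/idP/eqP => // _; apply/eqP/negPn/negP => lk.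
  have /negP := irr l; apply; apply: le_trans (lex1 _) _.
  by rewrite -[\top]kT; apply: joins_sup; rewrite eq_sym.
exists unit, (fun=> \top); split; last by rewrite card_unit.
by case; rewrite big_pred0 // => -[].
Qed.

Section PowerFactor.
Variable m : nat.

(** The factors have different displays, so the display is given as a family; [None] singles out the
    lattice of breadth three. *)
Definition flat_pow_disp (i : option 'I_m) : Order.disp_t :=
  if i is Some _ then Order.BoolOrder.bool_display else Order.Disp tt tt.

Definition flat_pow_factor (i : option 'I_m) : finTBLatticeType (flat_pow_disp i) :=
  match i return finTBLatticeType (flat_pow_disp i) with Some _ => bool | None => flat end.

Definition flat_pow : Type :=
  dprodL (fun i => flat_pow_factor i : tbLatticeType (flat_pow_disp i)).
HB.instance Definition _ := Order.TBLattice.on flat_pow.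
HB.instance Definition _ :=
  Finite.copy flat_pow {dffun forall i : option 'I_m, flat_pow_factor i}.

Lemma flat_pow_upper_semimodular : upper_semimodular flat_pow.
Proof.
apply: upper_semimodular_dprod => -[i|].
  exact: bool_upper_semimodular.
exact: upper_semimodular_flat.
Qed.

Lemma flat_pow_has_breadth : has_breadth flat_pow (3 + m).
Proof.
have -> : (3 + m = \sum_(i : option 'I_m) if i is Some _ then 1 else 3)%N.
  rewrite (bigD1 None) //= (eq_bigr (fun=> 1%N)) => [|[]//].
  by rewrite sum1_card cardC1 card_option card_ord.
apply: has_breadth_dprod => -[i|]; [exact: bool_has_breadth|exact: flat_has_breadth].
Qed.

Lemma flat_pow_not_c1_median : ~ c1_median_property flat_pow.
Proof.
move=> cm; apply: flat_not_c1_median.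
by apply: (c1_median_factor (fun i => finite_length_fin (flat_pow_factor i)) (i := None)).
Qed.

End PowerFactor.

Theorem theorem4p1 :
  (* (i) *)
  (forall (d : Order.disp_t) (L : tbLatticeType d),
     finite_length L -> upper_semimodular L ->
     (exists n : nat, has_breadth L n /\ (n <= 2)%N) ->
     c1_median_property L) /\
  (* (ii) *)
  (forall k : nat, (3 <= k)%N ->
     exists (d : Order.disp_t) (L : finTBLatticeType d),
       upper_semimodular L /\ has_breadth L k /\ ~ c1_median_property L) /\
  (* (iii) *)
  (forall (t : nat) (dL : 'I_t -> Order.disp_t)
          (L : forall i : 'I_t, tbLatticeType (dL i)),
     (0 < t)%N ->
     (forall i, finite_length (L i)) ->
     (forall i, c1_median_property (L i)) ->
     [/\ finite_length (dprodL L),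
         c1_median_property (dprodL L),
         (forall b : 'I_t -> nat, (forall i, has_breadth (L i) (b i)) ->
            has_breadth (dprodL L) (\sum_(i < t) b i)%N)
       & ((forall i, upper_semimodular (L i)) -> upper_semimodular (dprodL L))]).
Proof.
split; first by move=> d L fl usm [n [hb n2]]; exact: breadth_le2_c1_median fl usm _ hb n2.
split=> [k k3|t dL L _ fl cm].
  exists _, (flat_pow (k - 3)); split; first exact: flat_pow_upper_semimodular.
  split; last exact: flat_pow_not_c1_median.
  by have := flat_pow_has_breadth (k - 3); rewrite subnKC.
split.
- exact: finite_length_dprod.
- exact: c1_median_dprod.
- exact: has_breadth_dprod.
- exact: upper_semimodular_dprod.
Qed.
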